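(* Let $R$ be a left Artinian local ring such that $\operatorname{socle}(R)$ is central in $R$, and let $M$ be any faithful left $R$-module such that no proper submodule of $M$ and no proper homomorphic image of $M$ is faithful. Then $$\dim_{R/J(R)}(M/J(R)M)\ +\ \dim_{R/J(R)}(\operatorname{socle}(M))\ \leq\ \dim_{R/J(R)}(\operatorname{socle}(R))\ +\ 1.$$
   Context: Rings are associative and unital, not assumed commutative. $J(R)$ denotes the Jacobson radical of $R$; $R$ is local if $R/J(R)$ is a division ring. The socle of a module $M$, $\operatorname{socle}(M)$, is the sum of its simple submodules. The socle of a ring $R$, $\operatorname{socle}(R)$, is the sum of all minimal nonzero two-sided ideals of $R$; for $R$ left or right Artinian it equals the intersection of the socles of $R$ as a left module and as a right module over itself. $J(R)$ annihilates $M/J(R)M$, $\operatorname{socle}(M)$ and $\operatorname{socle}(R)$ (the latter on both sides), so these are vector spaces over $R/J(R)$. A proper homomorphic image of $M$ is a quotient $M/N$ with $N\ne 0$. *)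

(* Defs.v *)
From mathcomp Require Import all_boot all_algebra.
From mathcomp Require Import boolp classical_sets.

Set Implicit Arguments.
Unset Strict Implicit.
Unset Printing Implicit Defensive.

Import GRing.Theory.

Local Open Scope classical_set_scope.
Local Open Scope ring_scope.

(* The additive subgroup generated by A when A is stable under opposite; when
   A is a union of submodules this is their sum. *)
Definition finite_sums (V : nmodType) (A : set V) : set V :=
  [set x | exists2 s : seq V,
     (forall y, y \in s -> A y) & x = \sum_(y <- s) y].

Section Modules.
Variables (R : nzRingType) (V : lmodType R).

Definition submodule (N : set V) : Prop :=
  N 0 /\ (forall (a : R) (u v : V), N u -> N v -> N (a *: u + v)).

Definition simple_submodule (S : set V) : Prop :=
  [/\ submodule S, S <> [set 0] &
      forall N, submodule N -> N `<=` S -> N = [set 0] \/ N = S].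

Definition module_socle : set V :=
  finite_sums (\bigcup_(S in simple_submodule) S).

(* The subquotient A / B is faithful: only r = 0 satisfies r A `<=` B. It is
   used for M itself (setT / 0), submodules (N / 0) and quotients (setT / N). *)
Definition faithful (A B : set V) : Prop :=
  forall r : R, (forall x, A x -> B (r *: x)) -> r = 0.

End Modules.

Section Rings.
Variable R : nzRingType.

(* Left ideals are the submodules of the regular left module R^o. *)
Definition left_ideal (I : set R) : Prop := @submodule R R^o I.

Definition ideal (I : set R) : Prop :=
  left_ideal I /\ (forall x a : R, I x -> I (x * a)).

Definition left_artinian : Prop :=
  forall I : nat -> set R,
    (forall n, left_ideal (I n)) -> (forall n, I n.+1 `<=` I n) ->
    exists n, forall m, (n <= m)%N -> I m = I n.

Definition maximal_left_ideal (I : set R) : Prop :=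
  [/\ left_ideal I, I <> setT &
      forall K, left_ideal K -> I `<=` K -> K = I \/ K = setT].

Definition jacobson : set R := \bigcap_(I in maximal_left_ideal) I.

(* R / J(R) is a division ring, written on representatives. *)
Definition local_ring : Prop :=
  ~ jacobson 1 /\
  (forall a : R, ~ jacobson a ->
     exists b : R, jacobson (a * b - 1) /\ jacobson (b * a - 1)).

Definition minimal_ideal (I : set R) : Prop :=
  [/\ ideal I, I <> [set 0] &
      forall K, ideal K -> K `<=` I -> K = [set 0] \/ K = I].

Definition ring_socle : set R :=
  finite_sums (\bigcup_(I in minimal_ideal) I).

Definition central (A : set R) : Prop :=
  forall x r : R, A x -> r * x = x * r.

Definition jacobson_mul (V : lmodType R) : set V :=
  finite_sums [set r *: v | r in jacobson & v in [set: V]].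

(* For submodules B `<=` A of V with J(R) A `<=` B, the quotient A / B is a left
   vector space over R / J(R), the class of r acting as r. [residue_dim A B n]
   says that A / B has an n-element basis over R / J(R), the basis vectors and
   the coefficients being given by representatives in A and in R. *)
Definition residue_dim (V : lmodType R) (A B : set V) (n : nat) : Prop :=
  exists e : 'I_n -> V,
    [/\ forall i, A (e i),
        forall x, A x -> exists r : 'I_n -> R, B (x - \sum_i r i *: e i) &
        forall r : 'I_n -> R,
          B (\sum_i r i *: e i) -> forall i, jacobson (r i)].

End Rings.

Arguments left_artinian R : clear implicits.
Arguments jacobson R : clear implicits.
Arguments local_ring R : clear implicits.
Arguments ring_socle R : clear implicits.
Arguments jacobson_mul {R} V.
Arguments module_socle {R} V.

(* Main.v *)
Require Import Defs.
From HB Require Import structures.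
From mathcomp Require Import all_boot all_algebra.
From mathcomp Require Import boolp classical_sets.
From mathcomp Require Import zify.

(* Write k = R / J(R) and L = socle(R).  As L is central and nonzero, k is a
   field, and the elements of L act on M as linear maps from V = M / J(R)M to
   W = socle(M).  Every nonzero ideal of R meets L, so the two minimality
   conditions on M say that each hyperplane of V is the kernel, and each line
   of W the image, of a rank one map in L.  It remains to show that a space L
   of matrices with this property has dimension at least dim V + dim W - 1.
   Take nonzero subspaces A of V^* and B of W, as large as possible, such that
   the intersection of L with the tensor product of A and B has dimension at
   least dim A + dim B - 1.  By maximality, if f (x) w lies in L, then f lies
   in A if and only if w lies in B.  Fix a nonzero a in A.  For f outside A, L
   contains some f (x) w and (f + a) (x) w', and w, w' are not proportional,
   since otherwise a (x) w would be in L with w outside B.  So each dimension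
   of V^* / A contributes 2 to dim L, and likewise each dimension of W / B:
   dim L >= dim A + dim B - 1 + 2 max (dim V^* / A, dim W / B). *)

Set Implicit Arguments.
Unset Strict Implicit.
Unset Printing Implicit Defensive.

Import GRing.Theory.

Local Open Scope classical_set_scope.
Local Open Scope ring_scope.

(** * Spaces of matrices covered by rank one matrices *)

Lemma dim_addv_line (K : fieldType) (vT : vectType K) (U : {vspace vT}) v :
  v \notin U -> \dim (U + <[v]>) = (\dim U).+1.
Proof.
move=> vU; have v0: v != 0 by apply: contraNneq vU => ->; rewrite mem0v.
rewrite dimv_disjoint_sum ?dim_vline ?v0 ?addn1 //.
apply/eqP; rewrite -subv0; apply/subvP=> x /memv_capP[xU /vlineP[c xc]].
have [c0|c0] := eqVneq c 0; first by rewrite xc c0 scale0r mem0v.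
case/negP: vU; rewrite -[v](scalerK c0) -xc; exact: memvZ.
Qed.

Lemma notin_codim (K : fieldType) (vT : vectType K) (U : {vspace vT}) :
  (\dim U < dim vT)%N -> exists v, v \notin U.
Proof.
move=> lt; have /subvPn[v _ vU] : ~~ (fullv <= U)%VS.
  by apply: contraL lt => /dimvS; rewrite dimvf -leqNgt.
by exists v.
Qed.

Section RankOne.
Variables (F : fieldType) (m n : nat).
Implicit Types (A : {vspace 'cV[F]_m}) (B : {vspace 'rV[F]_n}).
Implicit Types (L : {vspace 'M[F]_(m, n)}) (f : 'cV[F]_m) (w : 'rV[F]_n).

(** Columns are functionals, rows are vectors: this is membership in the tensor product of [A] with
    the space of all rows, and [rows_in] is its mirror image. *)
Definition columns_in (A : {vspace 'cV[F]_m}) (T : 'M[F]_(m, n)) :=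
  forall y : 'cV_n, T *m y \in A.
Definition rows_in (B : {vspace 'rV[F]_n}) (T : 'M[F]_(m, n)) :=
  forall x : 'rV_m, x *m T \in B.

Lemma rV_neq0_contract w : w != 0 -> exists y : 'cV[F]_n, w *m y = 1%:M.
Proof.
case/rV0Pn=> j wj; exists (delta_mx j 0 *m (w 0 j)^-1%:M).
apply/matrixP=> i i'; rewrite !ord1 mulmxA -colE !mxE big_ord1 !mxE eqxx mulr1n.
by rewrite divff.
Qed.

Lemma cV_neq0_contract f : f != 0 -> exists x : 'rV[F]_m, x *m f = 1%:M.
Proof.
case/cV0Pn=> j wj; exists ((f j 0)^-1%:M *m delta_mx 0 j).
apply/matrixP=> i i'; rewrite !ord1 -mulmxA -rowE !mxE big_ord1 !mxE eqxx mulr1n.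
by rewrite mulVf.
Qed.

Lemma columns_in_span A (X : seq 'M[F]_(m, n)) T :
  {in X, forall T, columns_in A T} -> T \in <<X>>%VS -> columns_in A T.
Proof.
move=> XA XT y; rewrite (coord_span (X := in_tuple X) XT) mulmx_suml memv_suml // => i _.
by rewrite -scalemxAl memvZ // XA ?mem_nth.
Qed.

Lemma rows_in_span B (X : seq 'M[F]_(m, n)) T :
  {in X, forall T, rows_in B T} -> T \in <<X>>%VS -> rows_in B T.
Proof.
move=> XB XT y; rewrite (coord_span (X := in_tuple X) XT) mulmx_sumr memv_suml // => i _.
by rewrite -scalemxAr memvZ // XB ?mem_nth.
Qed.

Lemma columns_in_rank1 A f w : w != 0 -> columns_in A (f *m w) -> f \in A.
Proof.
by case/rV_neq0_contract=> y wy /(_ y); rewrite -mulmxA wy mulmx1.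
Qed.

Lemma rows_in_rank1 B f w : f != 0 -> rows_in B (f *m w) -> w \in B.
Proof.
by case/cV_neq0_contract=> x fx /(_ x); rewrite mulmxA fx mul1mx.
Qed.

Lemma mem_columns_in A f w : f \in A -> columns_in A (f *m w).
Proof.
by move=> fA y; rewrite -mulmxA [w *m y]mx11_scalar mul_mx_scalar memvZ.
Qed.

Lemma mem_rows_in B f w : w \in B -> rows_in B (f *m w).
Proof.
by move=> wB x; rewrite mulmxA [x *m f]mx11_scalar mul_scalar_mx memvZ.
Qed.

(** Induction on the codimension of [A]: for [f] outside [A], pass to [A + <[f]>]. Modulo matrices
    with columns in [A], the two given elements of [L] become [f *m w] and [f *m w']; these are
    independent because [w'] is no multiple of [w], so [X] grows by two. *)
Lemma dim_ge_double_codim L A a (X : seq 'M[F]_(m, n)) :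
    a \in A -> free X -> {in X, forall T, T \in L /\ columns_in A T} ->
    (forall f, f \notin A -> exists w w',
       [/\ w != 0, forall z, w' <> z *: w, f *m w \in L & (f + a) *m w' \in L]) ->
  (size X + 2 * (m - \dim A) <= \dim L)%N.
Proof.
move=> aA Xfree XLA; have [d] := ubnP (m - \dim A).
elim: d => // d IH in A X aA Xfree XLA *; rewrite ltnS => led HA.
have XL : (<<X>> <= L)%VS by apply/span_subvP => T /XLA[].
have [mA|mA] := leqP m (\dim A).
  rewrite (_ : (m - _ = 0)%N); last exact/eqP.
  by rewrite muln0 addn0 -(eqP Xfree) dimvS.
have [f fA] : exists f, f \notin A by apply: notin_codim; rewrite /dim /= muln1.
have [w [w' [w0 ww' fw fw']]] := HA f fA.
have XA T : T \in <<X>>%VS -> columns_in A T.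
  by apply: columns_in_span => U /XLA[].
have free1 : free (f *m w :: X).
  rewrite free_cons Xfree andbT; apply/negP => /XA /columns_in_rank1 fA'.
  by rewrite fA' in fA.
(* A dependency would give [f *m (w' - z *: w)] its columns in [A], hence [f] in [A] unless
   [w' = z *: w]. *)
have free2 : free ((f + a) *m w' :: f *m w :: X).
  rewrite free_cons free1 andbT; apply/negP; rewrite span_cons.
  case/memv_addP=> _ /vlineP[z ->] [T /XA TA E].
  apply: (ww' z); apply/eqP; rewrite -subr_eq0; apply/negPn/negP => n0.
  case/negP: fA; apply: (columns_in_rank1 n0) => y.
  have -> : f *m (w' - z *: w) = T - a *m w'.
    rewrite mulmxBr -scalemxAr -[T](addKr (z *: (f *m w))) -E mulmxDl.
    by rewrite addrA addrK addrC.
  by rewrite mulmxBl memvB ?TA // mem_columns_in.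
have sA : (A <= A + <[f]>)%VS by apply: addvSl.
have fA' : f \in (A + <[f]>)%VS by apply: subvP (memv_line f); apply: addvSr.
have /IH := free2; move/(_ (A + <[f]>)%VS); rewrite dim_addv_line //= => H.
have := H (subvP sA _ aA); clear H => H.
suff: ((size X).+2 + 2 * (m - (\dim A).+1) <= \dim L)%N.
  by apply: leq_trans; rewrite -(subnSK mA) mulnS addnA addn2.
apply: H => [T|| g].
- rewrite !inE => /or3P[/eqP->|/eqP->|/XLA[TL TA]]; split=> //.
  + by apply: mem_columns_in; rewrite memvD // (subvP sA).
  + exact: mem_columns_in.
  + by move=> y; apply: (subvP sA).
- by rewrite -ltnS -subSn // subSS; apply: leq_trans led; rewrite ltnS leq_sub2l.
- by move=> gA; apply: HA; apply: contra gA; apply: (subvP sA).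
Qed.

End RankOne.

Section RankOneCover.
Variables (F : fieldType) (m n : nat).
Implicit Types (A : {vspace 'cV[F]_m}) (B : {vspace 'rV[F]_n}).
Implicit Types (L : {vspace 'M[F]_(m, n)}) (f : 'cV[F]_m) (w : 'rV[F]_n).

(** Follows from [dim_ge_double_codim] by transposition, taken as injective linear maps [tr] and
    [trr] so that images of subspaces keep their dimension. *)
Lemma dim_ge_double_codim_row L B b (X : seq 'M[F]_(m, n)) :
    b \in B -> free X -> {in X, forall T, T \in L /\ rows_in B T} ->
    (forall w, w \notin B -> exists f f',
       [/\ f != 0, forall z, f' <> z *: f, f *m w \in L & f' *m (w + b) \in L]) ->
  (size X + 2 * (n - \dim B) <= \dim L)%N.
Proof.
move=> bB Xfree XLB HB.
pose tr := linfun (trmx : 'M[F]_(m, n) -> 'M[F]_(n, m)).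
pose trr := linfun (trmx : 'rV[F]_n -> 'cV[F]_n).
have trK T : tr T = T^T by rewrite lfunE.
have trrK w : trr w = w^T by rewrite lfunE.
have tr_mem T : (T^T \in (tr @: L)%VS) = (T \in L).
  rewrite -trK; apply/memv_imgP/idP => [[U UL]|TL]; last by exists T.
  by rewrite !trK => /trmx_inj->.
have trr_mem w : (w^T \in (trr @: B)%VS) = (w \in B).
  rewrite -trrK; apply/memv_imgP/idP => [[U UL]|TL]; last by exists w.
  by rewrite !trrK => /trmx_inj->.
have kertr : lker tr == 0%VS by apply/lker0P => T U; rewrite !trK => /trmx_inj.
have kertrr : lker trr == 0%VS by apply/lker0P => T U; rewrite !trrK => /trmx_inj.
rewrite -(limg_dim_eq (f := tr) (U := L)) ?(eqP kertr) ?capv0 //.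
rewrite -(limg_dim_eq (f := trr) (U := B)) ?(eqP kertrr) ?capv0 //.
rewrite -(size_map tr X); apply: (@dim_ge_double_codim _ _ _ _ _ b^T).
- by rewrite trr_mem.
- rewrite /free -limg_span limg_dim_eq ?(eqP kertr) ?capv0 //.
  by rewrite size_map; exact: Xfree.
- move=> _ /mapP[T /XLB[TL TB] ->]; rewrite trK tr_mem; split=> // y.
  by rewrite -[y]trmxK -trmx_mul trr_mem TB.
- move=> f; rewrite -[f]trmxK trr_mem => /HB[g [g' [g0 gg' fg fg']]].
  exists g^T, g'^T; rewrite trmx_eq0 -!linearD /= -!trmx_mul !tr_mem; split=> // z.
  by rewrite -linearZ => /trmx_inj /gg'.
Qed.

(** * Tight pairs of subspaces *)

Definition tight L A B := exists X : seq 'M[F]_(m, n),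
  [/\ free X, {in X, forall T, [/\ T \in L, columns_in A T & rows_in B T]} &
      (\dim A + \dim B <= size X + 1)%N].

(** The matrix [f *m w] fits in the larger pair but not in the smaller one, so it is independent of
    the old family and pays for one extra dimension. *)
Lemma tight_extend L A B A' B' f w :
    tight L A B -> (A <= A')%VS -> (B <= B')%VS -> f \in A' -> w \in B' ->
    f *m w \in L -> f != 0 -> w != 0 -> (f \notin A) || (w \notin B) ->
    (\dim A' + \dim B' <= (\dim A + \dim B).+1)%N ->
  tight L A' B'.
Proof.
move=> [X [Xfree XL leX]] sA sB fA' wB' fwL f0 w0 notAB led.
exists (f *m w :: X); split; last by rewrite /=; lia.
  rewrite free_cons Xfree andbT; apply/negP => mem_fw.
  case/orP: notAB => /negP; apply.
    apply: (columns_in_rank1 w0); apply: columns_in_span mem_fw.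
    by move=> T /XL[].
  apply: (rows_in_rank1 f0); apply: rows_in_span mem_fw.
  by move=> T /XL[].
move=> T; rewrite inE => /orP[/eqP->|/XL[TL TA TB]]; split=> //.
- exact: mem_columns_in.
- exact: mem_rows_in.
- by move=> y; apply: (subvP sA).
- by move=> y; apply: (subvP sB).
Qed.

Variable L : {vspace 'M[F]_(m, n)}.
Hypothesis Lf : forall f, f != 0 -> exists2 w, w != 0 & f *m w \in L.
Hypothesis Lw : forall w, w != 0 -> exists2 f, f != 0 & f *m w \in L.

(** Induction on the total codimension replaces the choice of a maximal pair: a rank one element of
    [L] with exactly one factor inside its subspace lets the pair grow by one dimension. When there
    is none, the doubling lemmas apply on both sides. *)
Lemma tight_dim A B a b :
  a \in A -> a != 0 -> b \in B -> b != 0 -> tight L A B -> (m + n <= \dim L + 1)%N.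
Proof.
have [d] := ubnP (m - \dim A + (n - \dim B)).
elim: d => // d IH in A B a b *; rewrite ltnS => led aA a0 bB b0 AB.
have dA : (\dim A <= m)%N by rewrite (leq_trans (dimvS (subvf A))) // dimvf /dim /= muln1.
have dB : (\dim B <= n)%N by rewrite (leq_trans (dimvS (subvf B))) // dimvf /dim /= mul1n.
have [[f [w [f0 w0 fA wB fwL]]]|noA] := pselect (exists f w,
    [/\ f != 0, w != 0, f \notin A, w \in B & f *m w \in L]).
  have dA' := dim_addv_line fA.
  have dA'm : (\dim (A + <[f]>)%VS <= m)%N.
    by rewrite (leq_trans (dimvS (subvf _))) // dimvf /dim /= muln1.
  apply: (IH (A + <[f]>)%VS B a b) => //.
    by rewrite dA'; apply: leq_trans led; rewrite ltn_add2r ltn_sub2l -?dA'.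
    by apply: subvP aA; apply: addvSl.
  apply: (tight_extend (f := f) (w := w) AB); rewrite ?addvSl ?fA ?dA' //.
  by apply: subvP (memv_line f); apply: addvSr.
have [[f [w [f0 w0 fA wB fwL]]]|noB] := pselect (exists f w,
    [/\ f != 0, w != 0, f \in A, w \notin B & f *m w \in L]).
  have dB' := dim_addv_line wB.
  have dB'm : (\dim (B + <[w]>)%VS <= n)%N.
    by rewrite (leq_trans (dimvS (subvf _))) // dimvf /dim /= mul1n.
  apply: (IH A (B + <[w]>)%VS a b) => //.
    by rewrite dB'; apply: leq_trans led; rewrite ltn_add2l ltn_sub2l -?dB'.
    by apply: subvP bB; apply: addvSl.
  apply: (tight_extend (f := f) (w := w) AB); rewrite ?addvSl ?wB ?orbT ?dB' ?addnS //.
  by apply: subvP (memv_line w); apply: addvSr.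
have {noA} noA f w : f \notin A -> w != 0 -> f *m w \in L -> w \notin B.
  move=> fA w0 fwL; apply/negP => wB; apply: noA; exists f, w; split=> //.
  by apply: contraNneq fA => ->; rewrite mem0v.
have {noB} noB f w : w \notin B -> f != 0 -> f *m w \in L -> f \notin A.
  move=> wB f0 fwL; apply/negP => fA; apply: noB; exists f, w; split=> //.
  by apply: contraNneq wB => ->; rewrite mem0v.
case: AB => X [Xfree XL leX].
(* Half the sum of the two bounds, combined with [leX], is the claim. *)
suff: (size X + 2 * (m - \dim A) <= \dim L)%N /\
      (size X + 2 * (n - \dim B) <= \dim L)%N by lia.
split.
- apply: (dim_ge_double_codim aA) => // [T /XL[]//|f fA].
  have nz g : g \notin A -> g != 0 by apply: contraNneq => ->; rewrite mem0v.
  have faA : f + a \notin A by apply: contra fA => /memvB/(_ aA); rewrite addrK.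
  have [w w0 fwL] := Lf (nz _ fA); have [w' w'0 fwL'] := Lf (nz _ faA).
  exists w, w'; split=> // z ew'.
  have z0 : z != 0 by apply: contraNneq w'0 => z0; rewrite ew' z0 scale0r.
  have wB : w \notin B by apply: noA fwL.
  suff awL : a *m w \in L by have := noB a w wB a0 awL; rewrite aA.
  move: fwL'; rewrite ew' -scalemxAr rpredZeq (negPf z0) /= mulmxDl.
  by move=> /memvB/(_ fwL); rewrite addrC addKr.
- apply: (dim_ge_double_codim_row bB) => // [T /XL[]//|w wB].
  have nz g : g \notin B -> g != 0 by apply: contraNneq => ->; rewrite mem0v.
  have wbB : w + b \notin B by apply: contra wB => /memvB/(_ bB); rewrite addrK.
  have [f f0 fwL] := Lw (nz _ wB); have [f' f'0 fwL'] := Lw (nz _ wbB).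
  exists f, f'; split=> // z ef'.
  have z0 : z != 0 by apply: contraNneq f'0 => z0; rewrite ef' z0 scale0r.
  have fA : f \notin A by apply: noB fwL.
  suff fbL : f *m b \in L by have := noA f b fA b0 fbL; rewrite bB.
  move: fwL'; rewrite ef' -scalemxAl rpredZeq (negPf z0) /= mulmxDr.
  by move=> /memvB/(_ fwL); rewrite addrC addKr.
Qed.

Lemma rank1_cover_dim : (m + n <= \dim L + 1)%N.
Proof.
suff start f w : f != 0 -> w != 0 -> f *m w \in L -> (m + n <= \dim L + 1)%N.
  (* Any nonzero column or row provides a rank one element to start from; when [m = n = 0] there is
     none and the bound is trivial. *)
  have [m0|m0] := posnP m; last first.
    have f0 : const_mx 1 != 0 :> 'cV[F]_m.
      by apply/cV0Pn; exists (Ordinal m0); rewrite mxE oner_eq0.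
    by have [w w0 fw] := Lf f0; apply: start fw.
  have [n0|n0] := posnP n; first by have -> : (m + n = 0)%N by rewrite m0 n0.
  have w0 : const_mx 1 != 0 :> 'rV[F]_n.
    by apply/rV0Pn; exists (Ordinal n0); rewrite mxE oner_eq0.
  by have [f f0 fw] := Lw w0; apply: start fw.
(* The lines of [f] and [w] form the initial tight pair: [1 + 1 <= 1 + 1]. *)
move=> f0 w0 fw; apply: (tight_dim (memv_line f) f0 (memv_line w) w0).
exists [:: f *m w]; split; last by rewrite !dim_vline f0 w0.
  rewrite seq1_free; apply: contraNneq f0 => fw0.
  have : columns_in 0%VS (f *m w) by rewrite fw0 => y; rewrite mul0mx mem0v.
  by move/(columns_in_rank1 w0); rewrite memv0.
move=> _ /[!inE] /eqP->; split=> //.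
- exact/mem_columns_in/memv_line.
- exact/mem_rows_in/memv_line.
Qed.

End RankOneCover.

(** * The Jacobson radical and the socles of a local ring *)

Lemma mem_finite_sums (V : nmodType) (A : set V) x : A x -> finite_sums A x.
Proof.
move=> Ax; exists [:: x]; last by rewrite big_seq1.
by move=> y; rewrite inE => /eqP->.
Qed.

(** * Submodules and Zorn's lemma *)

Section Submodules.
Variables (R : nzRingType) (V : lmodType R).
Implicit Types (N K : set V) (a : R) (u v x : V).

Lemma submoduleZ N a u : submodule N -> N u -> N (a *: u).
Proof. by move=> [N0 NP] Nu; rewrite -[a *: u]addr0; apply: NP. Qed.

Lemma submoduleD N u v : submodule N -> N u -> N v -> N (u + v).
Proof. by move=> [N0 NP] Nu Nv; rewrite -[u]scale1r; apply: NP. Qed.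

Lemma submoduleN N u : submodule N -> N u -> N (- u).
Proof. by move=> sN Nu; rewrite -scaleN1r; apply: submoduleZ. Qed.

Lemma submoduleB N u v : submodule N -> N u -> N v -> N (u - v).
Proof. by move=> sN Nu Nv; apply: submoduleD => //; apply: submoduleN. Qed.

Lemma submodule_set0 : submodule [set (0 : V)].
Proof. by split=> // a u v -> ->; rewrite scaler0 addr0. Qed.

Lemma submodule_add N x : submodule N -> submodule [set y | exists a, N (y - a *: x)].
Proof.
move=> sN; split=> [|a u v [b ub] [c vc]].
  by exists 0; rewrite scale0r subr0; case: sN.
exists (a * b + c); rewrite scalerDl -scalerA opprD addrACA -scalerBr.
by apply: submoduleD => //; apply: submoduleZ.
Qed.

Lemma submodule_finite_sums (A : set V) :
  (forall a x, A x -> A (a *: x)) -> submodule (finite_sums A).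
Proof.
move=> AZ; split=> [|a _ _ [s As ->] [s' As' ->]].
  by exists [::] => //; rewrite big_nil.
exists ([seq a *: y | y <- s] ++ s').
  move=> y; rewrite mem_cat => /orP[/mapP[z /As Az ->]|/As'//].
  exact: AZ.
by rewrite big_cat big_map scaler_sumr.
Qed.

Lemma finite_sums_sub (A N : set V) : submodule N -> A `<=` N -> finite_sums A `<=` N.
Proof.
move=> sN AN _ [s As ->]; elim: s As => [|y s IH] As.
  by rewrite big_nil; case: sN.
rewrite big_cons; apply: submoduleD => //; first by apply/AN/As/mem_head.
by apply: IH => z zs; apply: As; rewrite inE zs orbT.
Qed.

Lemma exists_max_submodule_avoiding N0 x : submodule N0 -> ~ N0 x ->
  exists N, [/\ submodule N, N0 `<=` N, ~ N x &
    forall K, submodule K -> N `<=` K -> ~ K x -> K = N].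
Proof.
move=> sN0 N0x.
pose good N := [/\ submodule N, N0 `<=` N & ~ N x].
have [|N [[-> |[sN N0N Nx]] maxN]] :=
    @Zorn_bigcup V [set N | N = set0 \/ good N].
- move=> F Fgood Ftot.
  have [[X0 [FX0 X0n]]|no] := pselect (exists X, F X /\ X <> set0); last first.
    left; apply/seteqP; split=> // y [X FX Xy]; apply: no.
    by exists X; split=> // Xn; rewrite Xn in Xy.
  right; have goodF X y : F X -> X y -> good X.
    by move=> FX Xy; case: (Fgood _ FX) => // Xn; rewrite Xn in Xy.
  have [sX0 NX0 _] : good X0 by case: (Fgood _ FX0).
  split; last 1 first.
  + by case=> X FX Xx; have [] := goodF _ _ FX Xx.
  + split=> [|a u v [X FX Xu] [Y FY Yv]]; first by exists X0 => //; case: sX0.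
    have [[_ XP] _ _] := goodF _ _ FX Xu; have [[_ YP] _ _] := goodF _ _ FY Yv.
    by have [XY|YX] := Ftot _ _ FX FY;
       [exists Y => //; apply: YP => //; apply: XY
       |exists X => //; apply: XP => //; apply: YX].
  + by move=> y /NX0 X0y; exists X0.
- have /maxN[] : set0 `<` N0.
    rewrite properEneq; split=> //; apply/eqP => e.
    by case: sN0 => + _; rewrite -e.
  by right; split.
- exists N; split=> // K sK NK Kx; apply: contrapT => KN.
  apply: (maxN K); last by right; split=> //; apply: subset_trans NK.
  by rewrite properEneq; split=> //; apply/eqP => e; apply: KN.
Qed.

End Submodules.

(** * The minimum condition and the radical *)

Section Artinian.
Variable R : nzRingType.
Implicit Types (I K : set R).

(** Without a minimal member below [I0], choice produces a strictly descending sequence of left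
    ideals. *)
Lemma artinian_exists_min (P : set (set R)) I0 : left_artinian R ->
    (forall I, P I -> left_ideal I) -> P I0 ->
  exists I, [/\ P I, I `<=` I0 & forall K, P K -> K `<=` I -> K = I].
Proof.
move=> art PI P0; apply: contrapT => nomin.
pose T := {I | P I /\ I `<=` I0}.
have next (X : T) : exists Y : T, sval Y `<=` sval X /\ sval Y <> sval X.
  case: X => X [PX XI0] /=; apply: contrapT => noY; apply: nomin.
  exists X; split=> // K PK KX; apply: contrapT => KnX; apply: noY.
  by exists (exist _ K (conj PK (subset_trans KX XI0))).
have [g gP] := choice next.
pose X n := iter n g (exist _ I0 (conj P0 (@subset_refl _ I0)) : T).
have [n|n|n stab] := art (fun n => sval (X n)).
- by apply: PI; case: (svalP (X n)).
- by have [] := gP (X n).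
- by have [_] := gP (X n); apply; apply: (stab n.+1); rewrite leqnSn.
Qed.

Lemma jacobson_left_ideal : left_ideal (jacobson R).
Proof.
split=> [I [[]]|a u v Ju Jv I mI] //.
have [sI _ _] := mI.
by apply: (submoduleD sI); [apply: (submoduleZ a sI (Ju _ _))|apply: Jv].
Qed.

(** Otherwise the left ideal generated by [1 - j] lies in a maximal left ideal; that one also
    contains [j], hence 1. *)
Lemma one_sub_jacobson_left_inv j : jacobson R j -> exists u : R, u * (1 - j) = 1.
Proof.
move=> Jj; apply: contrapT => noinv.
have sN0 : left_ideal [set x | exists a, x = a * (1 - j)].
  split=> [|a _ _ [b ->] [c ->]]; first by exists 0; rewrite mul0r.
  by exists (a * b + c); rewrite mulrDl -mulrA.
have [|N [sN N0N N1 maxN]] := exists_max_submodule_avoiding (x := 1 : R^o) sN0.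
  by move=> [a e]; apply: noinv; exists a.
have mN : maximal_left_ideal N.
  split=> // [NT|K sK NK]; first by apply: N1; rewrite NT.
  have [K1|K1] := pselect (K 1); [right|by left; apply: maxN].
  by apply/seteqP; split=> // x _; rewrite -[x]mulr1; apply: (submoduleZ x sK K1).
have Nj : N j by apply: Jj.
apply: N1; rewrite -[1](subrK j); apply: (submoduleD sN) => //.
by apply: N0N; exists 1; rewrite mul1r.
Qed.

End Artinian.
Arguments jacobson_left_ideal R : clear implicits.

Section Local.
Variables (R : nzRingType) (R_local : local_ring R).
Local Notation J := (jacobson R).

Lemma jacobson_sum_left_inv j : J j -> exists u : R, u * (1 + j) = 1.
Proof.
move=> Jj; have [|u] := @one_sub_jacobson_left_inv R (- j).
  exact: (submoduleN (jacobson_left_ideal R)).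
by rewrite opprK; exists u.
Qed.

Lemma jacobson_fixed (V : lmodType R) j (x : V) : J j -> x = j *: x -> x = 0.
Proof.
move=> Jj e; have [u ue] := one_sub_jacobson_left_inv Jj.
by rewrite -[x]scale1r -ue -scalerA scalerBl scale1r -e subrr scaler0.
Qed.

(** An inverse [b] modulo the radical lifts, since [b * r] is 1 plus a radical element. *)
Lemma local_left_inv r : ~ J r -> exists u : R, u * r = 1.
Proof.
move=> Jr; have [b [_ Jbr]] := R_local.2 r Jr.
have [u ue] := jacobson_sum_left_inv Jbr.
by exists (u * b); rewrite -mulrA; rewrite addrC subrK in ue.
Qed.

(** If [x * a] were outside [J], say [u * (x * a) = 1], then [1 - a * (u * x)] would be left
    invertible and yet kill [a], forcing [a = 0]. *)
Lemma jacobson_mulr x a : J x -> J (x * a).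
Proof.
move=> Jx; apply: contrapT => /local_left_inv[u uxa].
have /one_sub_jacobson_left_inv[v ve] : J (a * (u * x)).
  by rewrite mulrA; apply: (submoduleZ _ (jacobson_left_ideal R) Jx).
have a0 : a = 0.
  by rewrite -[a]mul1r -ve -mulrA mulrBl mul1r -!mulrA uxa mulr1 subrr mulr0.
by have := oner_neq0 R; rewrite -uxa a0 !mulr0 eqxx.
Qed.

Lemma local_scale_inv (V : lmodType R) r (x : V) :
  ~ J r -> exists u, u *: (r *: x) = x.
Proof.
by move=> /local_left_inv[u ue]; exists u; rewrite scalerA ue scale1r.
Qed.

Lemma local_scale_eq0 (V : lmodType R) r (x : V) : x <> 0 -> r *: x = 0 -> J r.
Proof.
move=> x0 rx; apply: contrapT => /(local_scale_inv x)[u].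
by rewrite rx scaler0 => e; apply: x0.
Qed.

(** For [x] in a simple [S], the submodule [J x] is 0 or [S], and [S] is excluded since [x = i *: x]
    with [i] in [J] forces [x = 0]. Conversely, if [J] kills [x <> 0], every nonzero multiple of [x]
    has its coefficient outside [J] and so generates [x] back: [R x] is simple. *)
Lemma module_socleE (V : lmodType R) :
  module_socle V = [set x | forall j, J j -> j *: x = 0].
Proof.
have sub : submodule [set x : V | forall j, J j -> j *: x = 0].
  split=> [j _|a u v Ju Jv j Jj]; first by rewrite scaler0.
  by rewrite scalerDr scalerA Ju ?Jv ?addr0 //; apply: jacobson_mulr.
apply/seteqP; split.
  apply: finite_sums_sub sub _ => x [S [sS _ minS] Sx] j Jj.
  apply: contrapT => jx.
  have sJx : submodule [set i *: x | i in J].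
    split=> [|a _ _ [i Ji <-] [k Jk <-]].
      by exists 0; [case: (jacobson_left_ideal R)|rewrite scale0r].
    exists (a * i + k); last by rewrite scalerDl scalerA.
    by case: (jacobson_left_ideal R) => _; apply.
  case: (minS _ sJx) => [_ [i _ <-]|e|e]; first exact: submoduleZ.
    by apply: jx; have : [set i *: x | i in J] (j *: x); [exists j|rewrite e].
  have : [set i *: x | i in J] x by rewrite e.
  by move=> [i Ji /esym/(jacobson_fixed Ji) x0]; apply: jx; rewrite x0 scaler0.
move=> x Jx; have [->|x0] := pselect (x = 0).
  by exists [::] => //; rewrite big_nil.
apply: mem_finite_sums; exists [set r *: x | r in [set: R]]; last first.
  by exists 1; rewrite ?scale1r.
split.
- split=> [|a _ _ [b _ <-] [c _ <-]]; first by exists 0; rewrite ?scale0r.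
  by exists (a * b + c) => //; rewrite scalerDl scalerA.
- move=> e; apply: x0; suff : [set r *: x | r in [set: R]] x by rewrite e.
  by exists 1; rewrite ?scale1r.
- move=> N sN NRx; have [[y [Ny y0]]|no] := pselect (exists y, N y /\ y <> 0).
    right; apply/seteqP; split=> // _ [r _ <-]; apply: submoduleZ => //.
    have [a _ ay] := NRx y Ny; rewrite -ay in Ny y0.
    have [|u <-] := @local_scale_inv V a x; last exact: submoduleZ.
    by move=> Ja; apply: y0; apply: Jx.
  left; apply/seteqP; split=> y; last by move->; case: sN.
  by move=> Ny; apply: contrapT => y0; apply: no; exists y.
Qed.

End Local.

Section Socle.
Variables (R : nzRingType) (R_local : local_ring R).
Local Notation J := (jacobson R).
Local Notation L := (ring_socle R).

Lemma ring_socle_left_ideal : left_ideal L.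
Proof.
apply: (@submodule_finite_sums R R^o) => a x [I mI Ix]; exists I => //.
by case: mI => [[sI _] _ _]; apply: (submoduleZ a sI Ix).
Qed.

Lemma ideal_nonzero_ex (V : zmodType) (I : set V) :
  I 0 -> I <> [set 0] -> exists2 x, I x & x <> 0.
Proof.
move=> I0 In0; apply: contrapT => no; apply: In0.
apply/seteqP; split=> [x Ix|_ ->] //.
by apply: contrapT => x0; apply: no; exists x.
Qed.

Hypothesis socle_central : central L.

(* An element t of a minimal ideal I generates it as a left ideal, being central,
   and J t is a smaller ideal: t = j t would force t = 0, as 1 - j is left
   invertible. *)
Lemma jacobson_mul_ring_socle t : L t -> forall j, J j -> j * t = 0.
Proof.
have sub : submodule [set t : R^o | forall j, J j -> j *: t = 0].
  rewrite -module_socleE //; apply: submodule_finite_sums => a x [S sS Sx].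
  by exists S => //; case: sS => sS _ _; apply: submoduleZ.
move: t; apply: (finite_sums_sub sub) => t [I mI It] j Jj.
have tC r : r * t = t * r.
  by apply: socle_central; apply: mem_finite_sums; exists I.
apply: contrapT => jt; case: mI => [[sI Ir] _ minI].
have idJt : ideal [set i * t | i in J].
  split; last first.
    by move=> _ a [i Ji <-]; exists (i * a); [exact: jacobson_mulr|rewrite -!mulrA tC].
  split=> [|a _ _ [i Ji <-] [k Jk <-]].
    by exists 0; [case: (jacobson_left_ideal R)|rewrite mul0r].
  exists (a * i + k); last by rewrite mulrDl -mulrA.
  by case: (jacobson_left_ideal R) => _; apply.
case: (minI _ idJt) => [_ [i _ <-]|e|e]; first exact: (submoduleZ i sI It).
  by apply: jt; have : [set i * t | i in J] (j * t); [exists j|rewrite e].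
have : [set i * t | i in J] t by rewrite e.
move=> [i Ji /esym it]; apply: jt.
by rewrite /GRing.scale /= (@jacobson_fixed R R^o i t Ji it) mulr0.
Qed.

Lemma ring_socle_mul_jacobson t : L t -> forall j, J j -> t * j = 0.
Proof. by move=> Lt j Jj; rewrite -socle_central // jacobson_mul_ring_socle. Qed.

(** Only elements of [J] kill [t], and centrality of [s * t] and of [t] gives
    [r * (s * t) = (s * t) * r = s * (r * t)]. *)
Lemma residue_comm t : L t -> t <> 0 -> forall r s, J (r * s - s * r).
Proof.
move=> Lt t0 r s; apply: (@local_scale_eq0 R R_local R^o _ t t0).
have Lr r' : L (r' * t) by apply: (submoduleZ r' ring_socle_left_ideal Lt).
rewrite /GRing.scale /= mulrBl -!mulrA (socle_central r (Lr s)) -mulrA.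
by rewrite -(socle_central r Lt) subrr.
Qed.

End Socle.

(** * The socle of a left Artinian ring *)

Section SocleArtinian.
Variables (R : nzRingType) (R_artinian : left_artinian R).
Local Notation J := (jacobson R).
Local Notation L := (ring_socle R).

Lemma ideal_meets_ring_socle I :
  ideal I -> I <> [set 0] -> exists t, [/\ L t, t <> 0 & I t].
Proof.
move=> idI In0.
have [|K [[idK Kn0] KI minK]] :=
    @artinian_exists_min R [set K | ideal K /\ K <> [set 0]] I R_artinian _
      (conj idI In0).
  by move=> K [[]].
have [|t Kt t0] := ideal_nonzero_ex _ Kn0; first by case: idK => [[]].
exists t; split=> //; last exact: KI.
apply: mem_finite_sums; exists K => //; split=> // K' idK' K'K.
by have [->|K'n0] := pselect (K' = [set 0]); [left|right; apply: minK].
Qed.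

Lemma ring_socle_nonzero : exists2 t, L t & t <> 0.
Proof.
have [||t [Lt t0 _]] := @ideal_meets_ring_socle setT.
- by split=> //; split.
- by move=> /seteqP[/(_ 1 I) /eqP]; rewrite oner_eq0.
- by exists t.
Qed.

(** The elements carrying [A] into [B] form a two-sided ideal, nonzero when [A / B] is not faithful.
    This converts the minimality of [M] into elements of [L]. *)
Lemma ring_socle_transporter (V : lmodType R) (A B : set V) :
    submodule A -> submodule B -> ~ faithful A B ->
  exists t, [/\ L t, t <> 0 & forall x, A x -> B (t *: x)].
Proof.
move=> sA sB nf; apply: (@ideal_meets_ring_socle [set r | forall x, A x -> B (r *: x)]).
  split; last first.
    move=> r a Br x Ax; rewrite -scalerA; apply: Br; exact: (submoduleZ a sA Ax).
  split=> [x _|a r s Br Bs x Ax]; first by rewrite scale0r; case: sB.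
  rewrite scalerDl -scalerA; case: sB => _; apply; [exact: Br|exact: Bs].
move=> e; apply: nf => r Br.
by have : [set r | forall x, A x -> B (r *: x)] r; [|rewrite e].
Qed.

Hypothesis R_local : local_ring R.

(** Take [N] maximal among the submodules above [N0] that avoid [e]. For [x] in [A] outside [N],
    adding [R x] captures [e], so [e - a *: x] is in [N] for some [a]; as [a] in [J] would put [e]
    in [N], [a] is left invertible and [x] is a multiple of [e] modulo [N]. *)
Lemma exists_hyperplane (V : lmodType R) (A N0 : set V) e :
    submodule A -> submodule N0 -> (forall j x, J j -> A x -> N0 (j *: x)) -> ~ N0 e ->
  exists N, [/\ submodule N, N0 `<=` N, ~ N e &
                forall x, A x -> exists b, N (x - b *: e)].
Proof.
move=> sA sN0 JA N0e.
have [N [sN N0N Ne maxN]] := exists_max_submodule_avoiding sN0 N0e.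
exists N; split=> // x Ax; have [Nx|Nx] := pselect (N x).
  by exists 0; rewrite scale0r subr0.
have [a Na] : exists a, N (e - a *: x).
  apply: contrapT => noa; apply: Nx; rewrite -(maxN _ (submodule_add x sN)) //.
    by exists 1; rewrite scale1r subrr; case: sN.
  by move=> y Ny; exists 0; rewrite scale0r subr0.
have [Ja|/(local_left_inv R_local)[u ua]] := pselect (J a).
  case: Ne; rewrite -[e](subrK (a *: x)); apply: submoduleD => //.
  exact/N0N/JA.
exists u; rewrite -opprB; apply: submoduleN => //.
rewrite -[X in _ - X]scale1r -ua -scalerA -scalerBr; exact: submoduleZ.
Qed.

Definition spanned (V : lmodType R) (A : set V) n :=
  exists l : 'I_n -> V, (forall i, A (l i)) /\
    forall x, A x -> exists r : 'I_n -> R, x = \sum_i r i *: l i.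

Hypothesis socle_central : central L.

(** In a minimal left ideal inside [L] with no finite spanning family, a hyperplane avoiding some
    [x <> 0] is smaller, hence finitely spanned; adding [x] to its family spans the whole. *)
Lemma ring_socle_spanned : exists n, @spanned R^o L n.
Proof.
apply: contrapT => nospan.
pose P := [set N : set R | [/\ left_ideal N, N `<=` L & ~ exists n, @spanned R^o N n]].
have [||N [[sN NL nosp] _ minN]] := @artinian_exists_min R P L R_artinian.
- by move=> I [].
- by split=> //; exact: ring_socle_left_ideal.
have [||x Nx x0] := @ideal_nonzero_ex R N; first by case: sN.
  move=> N0; apply: nosp; exists 0%N; exists (fun _ => 0); split=> [[]//|x].
  by rewrite N0 => ->; exists (fun _ => 0); rewrite big_ord0.
have [||||K [sK _ Kx hK]] := @exists_hyperplane R^o N [set 0] x.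
- exact: sN.
- exact: submodule_set0.
- by move=> j y Jj /NL Ly; apply: (jacobson_mul_ring_socle R_local socle_central Ly).
- exact: x0.
have : exists n, @spanned R^o (N `&` K) n.
  apply: contrapT => nosp'; apply: Kx.
  suff NK : N `&` K = N by move: Nx; rewrite -{1}NK => -[].
  apply: minN; last by move=> y [].
  split=> //; last by move=> y [/NL].
  split; first by split; [case: sN|case: sK].
  move=> a u v [Nu Ku] [Nv Kv].
  by split; [case: sN => _; apply|case: sK => _; apply].
case=> n [l [lN sp]]; apply: nosp; exists n.+1.
exists (fun i => if unlift ord0 i is Some j then l j else x); split.
  by move=> i; case: unlift => // j; case: (lN j).
move=> y Ny; have [b Kyb] := hK y Ny; have [|r er] := sp (y - b *: (x : R^o)).
  by split=> //; apply: (submoduleB sN Ny); apply: (submoduleZ b sN Nx).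
exists (fun i => if unlift ord0 i is Some j then r j else b).
rewrite big_ord_recl unlift_none; apply/eqP; rewrite addrC -subr_eq er; apply/eqP.
by apply: eq_bigr => i _; rewrite liftK.
Qed.

End SocleArtinian.

(** * Bases over the residue ring *)

Section Residue.
Variables (R : nzRingType) (R_local : local_ring R).
Local Notation J := (jacobson R).

Definition residue_free (V : lmodType R) (B : set V) n (e : 'I_n -> V) :=
  forall r : 'I_n -> R, B (\sum_i r i *: e i) -> forall i, J (r i).

(** A free family of greatest length is a basis; the bound [s] ensures that a greatest length
    exists. *)
Lemma residue_dim_exists (V : lmodType R) (A B : set V) (s : nat) :
    submodule A -> submodule B -> (forall j x, J j -> A x -> B (j *: x)) ->
    (forall n (e : 'I_n -> V), (forall i, A (e i)) -> residue_free B e -> (n <= s)%N) ->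
  exists2 n, (n <= s)%N & residue_dim A B n.
Proof.
move=> sA sB JA bound.
pose P n := `[< exists e : 'I_n -> V, (forall i, A (e i)) /\ residue_free B e >].
have P0 : exists n, P n.
  by exists 0%N; apply/asboolP; exists (fun _ => 0); split=> [[]//|r _ []].
have Ps n : P n -> (n <= s)%N by move=> /asboolP[e [Ae fe]]; apply: bound fe.
have [n /[dup] /Ps ns /asboolP[e [Ae fe]] maxn] := ex_maxnP P0 Ps.
exists n => //; exists e; split=> // x Ax.
pose e' i := if unlift ord0 i is Some j then e j else x.
(* By maximality, [x] followed by [e] is dependent. A coefficient of [x] in [J] would leave a
   dependency of [e] alone; otherwise it is left invertible and the relation is solved for [x]. *)
have [r [Br [i Jri]]] : exists r : 'I_n.+1 -> R,
    B (\sum_i r i *: e' i) /\ exists i, ~ J (r i).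
  apply: contrapT => no; have := maxn n.+1; rewrite ltnn => h; suff: false by [].
  apply: h; apply/asboolP; exists e'; split=> [i|r Br i].
    by rewrite /e'; case: unlift.
  by apply: contrapT => Ji; apply: no; exists r; split=> //; exists i.
move: Br; rewrite big_ord_recl {1}/e' unlift_none.
under eq_bigr do rewrite /e' liftK.
move=> Br; have [J0|J0] := pselect (J (r ord0)).
  have {}Br : B (\sum_i r (lift ord0 i) *: e i).
    rewrite -[X in B X](addKr (r ord0 *: x)); apply: submoduleD => //.
    by apply: submoduleN => //; apply: JA.
  case: Jri; case: (unliftP ord0 i) => [j|] -> //; exact: fe Br j.
have [u ur] := local_left_inv R_local J0.
exists (fun i => - (u * r (lift ord0 i))).
rewrite -sumrN; under eq_bigr do rewrite scaleNr opprK -scalerA.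
rewrite -scaler_sumr -[X in X + _]scale1r -ur -scalerA -scalerDr.
exact: submoduleZ.
Qed.

End Residue.

(** * The residue field *)

Section ResidueField.
Variables (R : nzRingType) (R_local : local_ring R).
Local Notation J := (jacobson R).
Hypothesis comm : forall r s : R, J (r * s - s * r).
Local Open Scope quotient_scope.

Let eqJ (r s : R) := `[< J (r - s) >].

Let sJ : left_ideal J. Proof. exact: jacobson_left_ideal. Qed.

Let eqJ_refl : reflexive eqJ.
Proof. by move=> r; apply/asboolP; rewrite subrr; case: sJ. Qed.
Let eqJ_sym : symmetric eqJ.
Proof.
move=> r s; apply/asboolP/asboolP => h; rewrite -opprB; exact: (submoduleN sJ).
Qed.
Let eqJ_trans : transitive eqJ.
Proof.
move=> s r t /asboolP rs /asboolP st; apply/asboolP.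
by rewrite -(subrK s r) -addrA; apply: (submoduleD sJ).
Qed.
Let eqJ_equiv := EquivRel eqJ eqJ_refl eqJ_sym eqJ_trans.
Let k := {eq_quot eqJ_equiv}.

Let pi (r : R) : k := \pi_k r.

Let piE r s : pi r = pi s <-> J (r - s).
Proof. by split=> [/eqmodP/asboolP|h] //; apply/eqmodP/asboolP. Qed.

Let pi_repr (x : k) : pi (repr x) = x. Proof. exact: reprK. Qed.

Let add (x y : k) := pi (repr x + repr y).
Let opp (x : k) := pi (- repr x).
Let mul (x y : k) := pi (repr x * repr y).
(** A chosen left inverse modulo [J]; the default value [x] makes 0 its own inverse. *)
Let inv (x : k) : k :=
  if pselect (exists u, J (u * repr x - 1)) is left h then pi (projT1 (cid h)) else x.

Let pi_add r s : add (pi r) (pi s) = pi (r + s).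
Proof.
apply/piE; rewrite opprD addrACA.
by apply: (submoduleD sJ); apply/piE; rewrite pi_repr.
Qed.
Let pi_opp r : opp (pi r) = pi (- r).
Proof.
by apply/piE; rewrite -opprD; apply: (submoduleN sJ); apply/piE; rewrite pi_repr.
Qed.
Let pi_mul r s : mul (pi r) (pi s) = pi (r * s).
Proof.
apply/piE; set r' := repr _; set s' := repr _.
have -> : r' * s' - r * s = r' * (s' - s) + (r' - r) * s.
  by rewrite mulrBr mulrBl addrA subrK.
apply: (submoduleD sJ).
  by apply: (submoduleZ r' sJ); apply/piE; rewrite pi_repr.
by apply: jacobson_mulr => //; apply/piE; rewrite pi_repr.
Qed.

Let addA : associative add.
Proof.
move=> x y z; rewrite -[x]pi_repr -[y]pi_repr -[z]pi_repr !pi_add.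
by rewrite addrA.
Qed.
Let addC : commutative add.
Proof. by move=> x y; rewrite -[x]pi_repr -[y]pi_repr !pi_add addrC. Qed.
Let add0 : left_id (pi 0) add.
Proof. by move=> x; rewrite -[x]pi_repr pi_add add0r. Qed.
Let addN : left_inverse (pi 0) opp add.
Proof. by move=> x; rewrite -[x]pi_repr pi_opp pi_add addNr. Qed.
Let mulA : associative mul.
Proof.
move=> x y z; rewrite -[x]pi_repr -[y]pi_repr -[z]pi_repr !pi_mul.
by rewrite mulrA.
Qed.
Let mulC : commutative mul.
Proof.
move=> x y; rewrite -[x]pi_repr -[y]pi_repr !pi_mul.
by apply/piE; apply: comm.
Qed.
Let mul1 : left_id (pi 1) mul.
Proof. by move=> x; rewrite -[x]pi_repr pi_mul mul1r. Qed.
Let mulD : left_distributive mul add.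
Proof.
move=> x y z; rewrite -[x]pi_repr -[y]pi_repr -[z]pi_repr !(pi_add, pi_mul).
by rewrite mulrDl.
Qed.
Let one_neq0 : pi 1 != pi 0.
Proof. by apply/eqP => /piE; rewrite subr0; case: R_local. Qed.

Let mulV (x : k) : x != pi 0 -> mul (inv x) x = pi 1.
Proof.
rewrite /inv; case: pselect => [h _|no /eqP x0].
  by case: cid => u /= hu; rewrite -[x in LHS]pi_repr pi_mul; apply/piE.
case: no; have [|u ue] := @local_left_inv R R_local (repr x).
  by move=> Jx; apply: x0; rewrite -[x]pi_repr; apply/piE; rewrite subr0.
by exists u; rewrite ue subrr; case: sJ.
Qed.
Let inv0 : inv (pi 0) = pi 0.
Proof.
rewrite /inv; case: pselect => // h; case: R_local => J1 _; case: J1.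
case: h => u hu; rewrite -[1](subKr (u * repr (pi 0))).
apply: (submoduleB sJ) => //; apply: (submoduleZ u sJ).
by rewrite -[repr _]subr0; apply/piE; rewrite pi_repr.
Qed.

(** Provides a field with a surjection from [R] of kernel [J], so that linear algebra over
    [R / J(R)] can be done with matrices. *)
Lemma residue_field : exists (F : fieldType) (p : {rmorphism R -> F}),
  (forall a, exists r, p r = a) /\ forall r, p r = 0 <-> J r.
Proof.
pose kT : choiceType := {eq_quot eqJ_equiv}.
pose zM := GRing.isZmodule.Build kT addA addC add0 addN.
pose kZ : zmodType := HB.pack (Choice.sort kT) zM kT.
pose cM := GRing.Zmodule_isComNzRing.Build kZ mulA mulC mul1 mulD one_neq0.
pose kC : comNzRingType := HB.pack (Choice.sort kT) cM kZ.
pose fM := GRing.ComNzRing_isField.Build kC mulV inv0.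
pose F : fieldType := HB.pack (Choice.sort kT) fM kC.
have pB : zmod_morphism (pi : R -> F).
  by move=> r s; rewrite -[RHS]/(add _ (opp _)) pi_opp pi_add.
have pM : monoid_morphism (pi : R -> F).
  by split=> // r s; rewrite -[RHS]/(mul _ _) pi_mul.
pose pA := GRing.isZmodMorphism.Build R F pi pB.
pose pMM := GRing.isMonoidMorphism.Build R F pi pM.
pose p : {rmorphism R -> F} := HB.pack pi pA pMM.
exists F, p; split=> [a|r]; first by exists (repr a); apply: pi_repr.
have h := piE r 0; rewrite subr0 in h; exact: h.
Qed.

End ResidueField.

(** * Minimal faithful modules *)

Section Steinitz.
Variables (R : nzRingType) (F : fieldType) (pi : {rmorphism R -> F}).
Hypothesis pi_surj : forall a, exists r, pi r = a.
Hypothesis pi_ker : forall r, pi r = 0 <-> jacobson R r.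

(** Steinitz's bound: if [s < n], the [n] by [s] matrix of coefficients has a nonzero left kernel
    vector, whose lift is a relation with a coefficient outside [J]. *)
Lemma residue_free_le (V : lmodType R) (A : set V) s n (e : 'I_n -> V) :
    (forall j x, jacobson R j -> A x -> j *: x = 0) ->
    spanned A s -> (forall i, A (e i)) -> residue_free [set 0] e -> (n <= s)%N.
Proof.
move=> JA [l [lA sp]] eA fe; rewrite leqNgt; apply/negP => sn.
have [c ec] := choice (fun i => sp _ (eA i)).
have [rho rhoK] := choice pi_surj.
pose C := \matrix_(i, j) pi (c i j).
have : kermx C != 0.
  by rewrite kermx_eq0 -row_leq_rank -ltnNge (leq_ltn_trans (rank_leq_col C)).
case/rowV0Pn=> v /sub_kermxP vC /rV0Pn[i /eqP]; apply.
rewrite -[v 0 i]rhoK; apply/pi_ker.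
apply: (fe (fun i => rho (v 0 i))) => /=.
under eq_bigr do rewrite ec scaler_sumr; rewrite exchange_big big1 //= => j _.
under eq_bigr do rewrite scalerA; rewrite -scaler_suml; apply: JA => //.
apply/pi_ker; rewrite rmorph_sum /=.
under eq_bigr do rewrite rmorphM rhoK.
have /matrixP/(_ 0 j) := vC; rewrite !mxE => vC0; rewrite -[RHS]vC0.
by apply: eq_bigr => k _; rewrite mxE.
Qed.

End Steinitz.

(** * The socle of the ring acting on the module *)

Section Main.
Variables (R : nzRingType) (M : lmodType R).
Hypotheses (R_artinian : left_artinian R) (R_local : local_ring R).
Hypothesis socle_central : central (ring_socle R).
Hypothesis M_faithful : faithful [set: M] [set 0].
Hypothesis no_faithful_sub : forall N : set M,
  submodule N -> N <> setT -> ~ faithful N [set 0].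
Hypothesis no_faithful_quo : forall N : set M,
  submodule N -> N <> [set 0] -> ~ faithful [set: M] N.
Local Notation J := (jacobson R).
Local Notation L := (ring_socle R).
Local Notation W := (module_socle M).
Local Notation JM := (jacobson_mul M).

Let submoduleT : submodule [set: M]. Proof. by []. Qed.

Let sJM : submodule JM.
Proof.
apply: submodule_finite_sums => a _ [r Jr [v _ <-]].
rewrite scalerA; exists (a * r); last by exists v.
exact: (submoduleZ a (jacobson_left_ideal R) Jr).
Qed.

Let sW : submodule W.
Proof.
apply: submodule_finite_sums => a x [S sS Sx]; exists S => //.
by case: sS => sS _ _; apply: submoduleZ.
Qed.

Let mem_JM j x : J j -> JM (j *: x).
Proof. by move=> Jj; apply: mem_finite_sums; exists j => //; exists x. Qed.

Let J_W j x : J j -> W x -> j *: x = 0.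
Proof. by move=> Jj; rewrite module_socleE // => /(_ j Jj). Qed.

Let L_JM t x : L t -> JM x -> t *: x = 0.
Proof.
move=> Lt; have : submodule [set x : M | t *: x = 0].
  split=> [|a u v /= tu tv]; first exact: scaler0.
  by rewrite scalerDr tv scalerA -(socle_central a Lt) -scalerA tu scaler0 addr0.
move=> sub; apply: (finite_sums_sub sub) => _ [r Jr [v _ <-]] /=.
by rewrite scalerA (ring_socle_mul_jacobson R_local) ?scale0r.
Qed.

Let L_scale t r (x : M) : L t -> t *: (r *: x) = r *: (t *: x).
Proof. by move=> Lt; rewrite !scalerA -(socle_central r Lt). Qed.

Let L_W t x : L t -> W (t *: x).
Proof.
move=> Lt; rewrite module_socleE // => j Jj.
by rewrite scalerA jacobson_mul_ring_socle // scale0r.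
Qed.

Let L_faithful t : (forall x : M, t *: x = 0) -> t = 0.
Proof. by move=> tM; apply: M_faithful => x _; apply: tM. Qed.

Let L_hyperplane (N : set M) : submodule N -> N <> setT ->
  exists t, [/\ L t, t <> 0 & forall x, N x -> t *: x = 0].
Proof.
move=> sN NT.
have sub0 := @submodule_set0 R M.
exact: (ring_socle_transporter R_artinian sN sub0 (no_faithful_sub sN NT)).
Qed.

Let L_line (N : set M) : submodule N -> N <> [set 0] ->
  exists t, [/\ L t, t <> 0 & forall x, N (t *: x)].
Proof.
move=> sN N0.
have [t [Lt t0 tN]] :=
  ring_socle_transporter R_artinian submoduleT sN (no_faithful_quo sN N0).
by exists t; split=> // x; apply: tN.
Qed.

Let L_free n (t : 'I_n -> R) : (forall i, L (t i)) ->
  (forall r : 'I_n -> R, \sum_i r i * t i = 0 -> forall i, J (r i)) ->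
  forall s, @spanned R R^o L s -> (n <= s)%N.
Proof.
move=> Lt ft s sp.
have [t0 Lt0 t0n] := ring_socle_nonzero R_artinian.
have [F [pi [pi_surj pi_ker]]] :=
  residue_field R_local (residue_comm R_local socle_central Lt0 t0n).
apply: (residue_free_le pi_surj pi_ker (A := L : set R^o) (e := t)) => //.
by move=> j x Jj Lx; apply: (jacobson_mul_ring_socle R_local socle_central Lx).
Qed.

(** Bounds the dimension of [M / J(R)M] by a dual family: [t i] in [L] vanishes on a hyperplane that
    contains [J(R)M] and all [e j] with [j != i], but not [e i]. Evaluation at the [e i] shows that
    the [t i] are independent. *)
Let top_free_le n (e : 'I_n -> M) : residue_free JM e ->
  forall s, @spanned R R^o L s -> (n <= s)%N.
Proof.
move=> fe s sp.
have ht i : exists t, [/\ L t, t *: e i <> 0 & forall j, j != i -> t *: e j = 0].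
  (* [J(R)M] plus the span of the [e j] other than [e i]. *)
  pose N0 := [set x | exists r : 'I_n -> R, r i = 0 /\ JM (x - \sum_j r j *: e j)].
  have JN0 : JM `<=` N0.
    move=> x xJ; exists (fun _ => 0); split=> //.
    by rewrite big1 ?subr0 // => j _; rewrite scale0r.
  have sN0 : submodule N0.
    split=> [|a u v [r [r0 ur]] [r' [r'0 vr]]]; first by apply: JN0; case: sJM.
    exists (fun j => a * r j + r' j); rewrite r0 r'0 mulr0 addr0; split=> //.
    under eq_bigr do rewrite scalerDl -scalerA.
    rewrite big_split /= -scaler_sumr opprD addrACA -scalerBr.
    by case: sJM => _; apply.
  have N0e : ~ N0 (e i).
    move=> [r [r0 ur]]; case: R_local => J1 _; apply: J1.
    have := fe (fun j => (j == i)%:R - r j); move/(_ _ i); rewrite eqxx r0 subr0.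
    apply; under eq_bigr do rewrite scalerBl.
    rewrite sumrB (bigD1 i) //= eqxx scale1r big1 ?addr0 // => j /negPf->.
    by rewrite scale0r.
  have JMN0 j x : J j -> [set: M] x -> N0 (j *: x) by move=> Jj _; apply/JN0/mem_JM.
  have [K [sK N0K Ke hK]] := exists_hyperplane R_local submoduleT sN0 JMN0 N0e.
  have [KT|t [Lt t0 tK]] := L_hyperplane sK; first by apply: Ke; rewrite KT.
  exists t; split=> // [te|j ji].
    apply: t0; apply: L_faithful => x; have [b Kx] := hK x I.
    by rewrite -[x](subrK (b *: e i)) scalerDr tK // L_scale // te scaler0 addr0.
  apply/tK/N0K; exists (fun k => (k == j)%:R); rewrite eq_sym (negPf ji); split=> //.
  rewrite (bigD1 j) //= eqxx scale1r big1 ?addr0 ?subrr; first by case: sJM.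
  by move=> k /negPf->; rewrite scale0r.
have [t tP] := choice ht.
apply: (@L_free n t) sp => [i|r rt i]; first by case: (tP i).
have [Lt te _] := tP i; apply: (local_scale_eq0 R_local te).
rewrite -[RHS](scale0r (e i)) -rt scaler_suml (bigD1 i) //= big1 ?addr0 ?scalerA //.
by move=> j ji; have [_ _ tj] := tP j; rewrite -scalerA tj ?scaler0 // eq_sym.
Qed.

Let line (x : M) : set M := [set y | exists a, y = a *: x].
Let sline x : submodule (line x).
Proof.
split=> [|a _ _ [b ->] [c ->]]; first by exists 0; rewrite scale0r.
by exists (a * b + c); rewrite scalerDl scalerA.
Qed.

Let free_neq0 n (e : 'I_n -> M) (r : 'I_n -> R) i :
  residue_free [set 0] e -> ~ J (r i) -> \sum_i r i *: e i <> 0.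
Proof. by move=> fe Jr /fe /(_ i). Qed.

(** Choose [t i <> 0] in [L] mapping [M] into the line of [e i]. In a relation among the [t i], a
    coefficient outside [J] would force every value of [t i] to be 0, since the [e i] are
    independent and killed by [J]. *)
Let socle_free_le n (e : 'I_n -> M) : (forall i, W (e i)) ->
  residue_free [set 0] e -> forall s, @spanned R R^o L s -> (n <= s)%N.
Proof.
move=> We fe s sp.
have ht i : exists t, [/\ L t, t <> 0 & forall x, line (e i) (t *: x)].
  apply: L_line => // l0.
  have e0 : e i = 0 by have : line (e i) (e i); [exists 1; rewrite scale1r|rewrite l0].
  case: R_local => J1 _; apply: J1.
  have := fe (fun j => (j == i)%:R); move/(_ _ i); rewrite eqxx; apply.
  by rewrite /= (bigD1 i) //= e0 scaler0 add0r big1 // => j /negPf->; rewrite scale0r.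
have [t tP] := choice ht.
apply: (@L_free n t) sp => [i|r rt i]; first by case: (tP i).
have [Lt t0 te] := tP i; apply: contrapT => Jr; apply: t0; apply: L_faithful => x.
have hc j : exists c, t j *: x = c *: e j by have [_ _ /(_ x)] := tP j.
have [c cP] := choice hc.
have : J (r i * c i).
  apply: (fe (fun i => r i * c i)) => /=.
  under eq_bigr do rewrite -scalerA -cP scalerA.
  by rewrite -scaler_suml rt scale0r.
have [u ur] := local_left_inv R_local Jr.
move=> Jrc; rewrite cP; apply: J_W (We i).
rewrite -[c i]mul1r -ur -mulrA; exact: (submoduleZ u (jacobson_left_ideal R) Jrc).
Qed.

(** * Matrices of the elements of the socle *)

Section Coordinates.
Variables (F : fieldType) (pi : {rmorphism R -> F}).
Hypothesis pi_surj : forall a, exists r, pi r = a.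
Hypothesis pi_ker : forall r, pi r = 0 <-> J r.
Variables (p q s : nat) (e : 'I_p -> M) (g : 'I_q -> M) (l : 'I_s -> R).
Hypothesis e_span : forall x, exists r : 'I_p -> R, JM (x - \sum_i r i *: e i).
Hypothesis e_free : residue_free JM e.
Hypothesis gW : forall j, W (g j).
Hypothesis g_span : forall x, W x -> exists r : 'I_q -> R, x = \sum_i r i *: g i.
Hypothesis g_free : residue_free [set 0] g.
Hypothesis lL : forall i, L (l i).
Hypothesis l_span : forall x, L x -> exists r : 'I_s -> R, x = \sum_i r i * l i.

(** In the bases [e] and [g], [L] becomes a space of matrices. Hyperplanes of [M / J(R)M] and lines
    of the socle supply the two hypotheses of [rank1_cover_dim]. *)
Lemma coordinates_dim : (p + q <= s + 1)%N.
Proof.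
have [rho rhoK] := choice pi_surj.
(* Row [i] of [T] holds the coordinates of [t *: e i]. This is a relation because the lifts [c] are
   determined only modulo [J]. *)
pose represents t (T : 'M[F]_(p, q)) := exists c : 'I_p -> 'I_q -> R,
  (forall i, t *: e i = \sum_j c i j *: g j) /\ forall i j, T i j = pi (c i j).
have g_uniq (r r' : 'I_q -> R) j :
    \sum_j r j *: g j = \sum_j r' j *: g j -> pi (r j) = pi (r' j).
  move=> rr'; apply/eqP; rewrite -subr_eq0 -rmorphB; apply/eqP/pi_ker.
  apply: (g_free (r := fun j => r j - r' j)) => /=.
  by under eq_bigr do rewrite scalerBl; rewrite sumrB rr' subrr.
have rep_ex t : L t -> exists T, represents t T.
  move=> Lt; have [c cP] := choice (fun i => g_span (L_W (e i) Lt)).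
  by exists (\matrix_(i, j) pi (c i j)), c; split=> // i j; rewrite mxE.
have rep_uniq t T T' : represents t T -> represents t T' -> T = T'.
  move=> [c [tc Tc]] [c' [tc' Tc']]; apply/matrixP => i j; rewrite Tc Tc'.
  by apply: g_uniq; rewrite -tc.
have rep_neq0 t T : L t -> t <> 0 -> represents t T -> T != 0.
  move=> Lt t0 [c [tc Tc]]; apply/eqP => T0; apply: t0; apply: L_faithful => x.
  have [r xr] := e_span x.
  rewrite -[x](subrK (\sum_i r i *: e i)) scalerDr L_JM // add0r scaler_sumr.
  rewrite big1 // => i _; rewrite L_scale // tc big1 ?scaler0 // => j _.
  by apply: J_W (gW j); apply/pi_ker; rewrite -Tc T0 mxE.
have [T TP] := choice (fun i => rep_ex _ (lL i)).
pose LL := <<codom T>>%VS.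
have dimLL : (\dim LL <= s)%N.
  by rewrite (leq_trans (dim_span _)) // size_codom card_ord.
have mem_LL t U : L t -> represents t U -> U \in LL.
  move=> Lt tU; have [r rt] := l_span Lt.
  have -> : U = \sum_i pi (r i) *: T i.
    apply: rep_uniq tU _; have [c cP] := choice TP.
    exists (fun k j => \sum_i r i * c i k j); split=> [k|k j].
      rewrite rt scaler_suml.
      under [RHS]eq_bigr do rewrite scaler_suml.
      rewrite exchange_big; apply: eq_bigr => i _ /=; rewrite -scalerA.
      have [-> _] := cP i; rewrite scaler_sumr.
      by apply: eq_bigr => j _; rewrite scalerA.
    rewrite summxE rmorph_sum; apply: eq_bigr => i _.
    by have [_ Tc] := cP i; rewrite mxE Tc rmorphM.
  apply: memv_suml => i _; apply/memvZ/memv_span; exact: codom_f.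
suff : (p + q <= \dim LL + 1)%N by move/leq_trans; apply; rewrite leq_add2r.
have piJ r : pi r != 0 -> ~ J r by move=> /eqP r0 /pi_ker.
apply: rank1_cover_dim => [f f0|w w0].
- have [i0 fi0] := cV0Pn _ f0.
  (* The kernel of the functional with coordinates [f], pulled back to [M]. *)
  pose H := [set x | exists r : 'I_p -> R,
    JM (x - \sum_i r i *: e i) /\ \sum_i pi (r i) * f i 0 = 0].
  have sH : submodule H.
    split=> [|a u v [r [ur rf]] [r' [vr rf']]].
      exists (fun _ => 0); rewrite big1 => [|i _]; last by rewrite scale0r.
      rewrite subrr big1 => [|i _]; last by rewrite rmorph0 mul0r.
      by split=> //; case: sJM.
    exists (fun j => a * r j + r' j); split.
      under eq_bigr do rewrite scalerDl -scalerA.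
      rewrite big_split /= -scaler_sumr opprD addrACA -scalerBr.
      by case: sJM => _; apply.
    under eq_bigr do rewrite rmorphD rmorphM mulrDl -mulrA.
    by rewrite big_split /= -mulr_sumr rf rf' mulr0 addr0.
  have sum_delta i : \sum_j (j == i)%:R *: e j = e i.
    rewrite (bigD1 i) //= eqxx scale1r big1 ?addr0 // => j /negPf->.
    by rewrite scale0r.
  (* Coordinates are unique modulo [J], so the functional takes the nonzero value [f i0 0] at
     [e i0]. *)
  have HT : H <> setT.
    move=> HT; have : H (e i0) by rewrite HT.
    move=> [r [er rf]]; case/eqP: fi0; rewrite -[RHS]rf (bigD1 i0) //= big1.
      rewrite (_ : pi (r i0) = 1) ?mul1r ?addr0 //.
      apply/esym/eqP; rewrite -subr_eq0 -(rmorph1 pi) -rmorphB; apply/eqP/pi_ker.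
      have := e_free (r := fun j => (j == i0)%:R - r j); move/(_ _ i0).
      rewrite eqxx; apply.
      by under eq_bigr do rewrite scalerBl; rewrite sumrB sum_delta.
    move=> i ii0; suff -> : pi (r i) = 0 by rewrite mul0r.
    apply/pi_ker; have := e_free (r := fun j => (j == i0)%:R - r j); move/(_ _ i).
    rewrite (negPf ii0) sub0r -{2}[r i]opprK => h.
    apply: (submoduleN (jacobson_left_ideal R)); apply: h.
    by under eq_bigr do rewrite scalerBl; rewrite sumrB sum_delta.
  have [t [Lt t0 tH]] := L_hyperplane sH HT.
  have [U tU] := rep_ex t Lt.
  (* [H] contains [e i] minus [f i 0 / f i0 0] times [e i0], and [t] kills [H]; so each row of [U]
     is that multiple of row [i0]. *)
  have UE : U = f *m ((f i0 0)^-1 *: row i0 U).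
    apply: (rep_uniq _ _ _ tU); have [c [tc Uc]] := tU.
    exists (fun i j => rho (f i 0 / f i0 0) * c i0 j); split=> [i|i j]; last first.
      by rewrite mxE big_ord1 !mxE rmorphM rhoK Uc mulrA.
    under eq_bigr do rewrite -scalerA.
    rewrite -scaler_sumr -tc -L_scale //; apply/eqP; rewrite -subr_eq0 -scalerBr.
    apply/eqP/tH; exists (fun j => (j == i)%:R - rho (f i 0 / f i0 0) * (j == i0)%:R).
    split.
      under eq_bigr do rewrite scalerBl -scalerA.
      by rewrite sumrB -scaler_sumr !sum_delta subrr; case: sJM.
    under eq_bigr do rewrite rmorphB rmorphM !rmorph_nat rhoK mulrBl -mulrA.
    rewrite sumrB -mulr_sumr (bigD1 i) //= eqxx mul1r big1 => [|j /negPf->]; last first.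
      by rewrite mul0r.
    rewrite addr0 (bigD1 i0) //= eqxx mul1r big1 => [|j /negPf->]; last first.
      by rewrite mul0r.
    by rewrite addr0 divfK ?subrr.
  exists ((f i0 0)^-1 *: row i0 U); last by rewrite -UE; apply: mem_LL tU.
  by apply: contraNneq (rep_neq0 t U Lt t0 tU) => w0; rewrite UE w0 mulmx0.
- have [j0 wj0] := rV0Pn _ w0.
  (* A lift of [w] to the socle. Some [t] in [L] maps [M] into the line of [v]; writing
     [t *: e i = d i *: v] exhibits its matrix as a column times [w]. *)
  pose v := \sum_j rho (w 0 j) *: g j.
  have v0 : v <> 0.
    by apply: (@free_neq0 q g (fun j => rho (w 0 j)) j0) => //; apply: piJ; rewrite rhoK.
  have [|t [Lt t0 tv]] := @L_line (line v) (sline v).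
    by move=> l0; apply: v0; have : line v v; [exists 1; rewrite scale1r|rewrite l0].
  have [d dP] := choice (fun i => tv (e i)).
  have tU : represents t ((\col_i pi (d i)) *m w).
    exists (fun i j => d i * rho (w 0 j)); split=> [i|i j].
      by rewrite dP scaler_sumr; apply: eq_bigr => j _; rewrite scalerA.
    by rewrite mxE big_ord1 mxE rmorphM rhoK.
  exists (\col_i pi (d i)); last exact: mem_LL tU.
  by apply: contraNneq (rep_neq0 _ _ Lt t0 tU) => ->; rewrite mul0mx.
Qed.

End Coordinates.

(** The length [n] of one finite spanning family of [L] bounds free families in all three spaces, so
    the three dimensions exist. *)
Lemma minimal_faithful_dim : exists p q s : nat,
    [/\ residue_dim [set: M] JM p, residue_dim W [set 0] q,
        @residue_dim R R^o L [set 0] s & (p + q <= s + 1)%N].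
Proof.
have [t0 Lt0 t0n] := ring_socle_nonzero R_artinian.
have [F [pi [pi_surj pi_ker]]] :=
  residue_field R_local (residue_comm R_local socle_central Lt0 t0n).
have [n sp] := ring_socle_spanned R_artinian R_local socle_central.
have [||p _ [e [_ e_span e_free]]] :=
  @residue_dim_exists R R_local M setT JM n submoduleT sJM.
- by move=> j x Jj _; apply: mem_JM.
- by move=> k e _ fe; apply: top_free_le fe _ sp.
have [||q _ [g [gW g_span g_free]]] :=
  @residue_dim_exists R R_local M W [set 0] n sW (@submodule_set0 R M).
- by move=> j x; apply: J_W.
- by move=> k g Wg fg; apply: socle_free_le Wg fg _ sp.
have [||s _ [l [lL l_span l_free]]] :=
  @residue_dim_exists R R_local R^o L [set 0] n (ring_socle_left_ideal R)
    (@submodule_set0 R R^o).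
- by move=> j x Jj Lx; apply: (jacobson_mul_ring_socle R_local socle_central Lx).
- by move=> k t Lt ft; apply: (L_free Lt ft sp).
exists p, q, s; split; [by exists e|by exists g|by exists l|].
apply: (coordinates_dim pi_surj pi_ker (e := e) (g := g) (l := l)) => //.
- by move=> x; apply: e_span.
- by move=> x /g_span[r /subr0_eq]; exists r.
- by move=> x /l_span[r /subr0_eq]; exists r.
Qed.

End Main.

Theorem theorem3 (R : nzRingType) (M : lmodType R)
    (R_artinian : left_artinian R) (R_local : local_ring R)
    (socle_central : central (ring_socle R))
    (M_faithful : faithful [set: M] [set 0])
    (no_faithful_sub : forall N : set M,
        submodule N -> N <> setT -> ~ faithful N [set 0])
    (no_faithful_quo : forall N : set M,
        submodule N -> N <> [set 0] -> ~ faithful [set: M] N) :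
  exists p q s : nat,
    [/\ residue_dim [set: M] (jacobson_mul M) p,
        residue_dim (module_socle M) [set 0] q,
        @residue_dim R R^o (ring_socle R) [set 0] s &
        (p + q <= s + 1)%N].
Proof. exact: minimal_faithful_dim. Qed.
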